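(* Let $\boldsymbol{L}=\langle L;\leq\rangle$ be an algebraic lattice whose join semilattice $\boldsymbol{S}=\langle S;+\rangle$ of compact elements is dually pseudo-complemented. Let $0$ and $1$ be the least and greatest elements of $\boldsymbol{L}$, respectively. Then the following conditions are equivalent: (i) $a=(a+c^* )\cdot(a+c^{**})$ for all $a,c\in S$; (ii) $a=(a+c^* )\cdot(a+c^{**})$ for every $a\in L$ and $c\in S$; (iii) whenever $a\in L\setminus\{1\}$ is meet-irreducible in $\boldsymbol{L}$, then the interval $[a,1)$ has a largest element; (iv) whenever $a\in L$ is completely meet-irreducible in $\boldsymbol{L}$, then $1$ is join-irreducible in the interval $[a,1]$.
   Context: In an algebraic lattice $\boldsymbol{L}$, $+$ denotes binary join; the compact elements form a join semilattice $\langle S;+\rangle$ with least element $0$, ordered by the restriction of $\leq$. For a join semilattice $\langle S;+\rangle$ with least element and $a\in S$, an element $b\in S$ is the dual pseudo-complement of $a$ if $\langle S;\leq\rangle$ has a greatest element $1$ and $b$ is the least element of $S$ with $a+b=1$; then $b$ is written $a^*$, and $a^{**}=(a^* )^*$. $\langle S;+\rangle$ is dually pseudo-complemented if each of its elements has a dual pseudo-complement. For $c\in S$, $c^*$ denotes the dual pseudo-complement of $c$ in $\boldsymbol{S}$. The equation $a\cdot b=c$ means that $c$ is the greatest lower bound of $a$ and $b$ (so $\cdot$ is a partial operation in a join semilattice): it is taken in $\langle S;\leq\rangle$ in condition (i) and in $\boldsymbol{L}$ in condition (ii). Intervals: $[a,1]=\{d\in L:a\leq d\}$ and $[a,1)=\{d\in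 L:a\leq d<1\}$. An element is completely meet-irreducible if it belongs to every set $X\subseteq L$ of which it is the meet; in particular $1$, the meet of $\emptyset$, is not completely meet-irreducible. $1$ is join-irreducible in $[a,1]$ if, for $x,y\in[a,1]$, $x+y=1$ implies $x=1$ or $y=1$. *)

(* Defs.v *)
From mathcomp Require Export all_boot all_order.
From mathcomp Require Export boolp classical_sets.

Set Implicit Arguments.
Unset Strict Implicit.
Unset Printing Implicit Defensive.

Local Open Scope classical_set_scope.
Local Open Scope order_scope.

Definition greatest (d : Order.disp_t) (T : porderType d) (A : set T) : set T :=
  (A `&` ubound A)%classic.

Definition least (d : Order.disp_t) (T : porderType d) (A : set T) : set T :=
  (A `&` lbound A)%classic.

(* [meet_in A a b c]: c is the greatest lower bound of a and b in the poset A
   with the order inherited from T, i.e. a . b = c as a partial operation. *)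
Definition meet_in (d : Order.disp_t) (T : porderType d) (A : set T)
    (a b c : T) : Prop :=
  greatest (A `&` lbound [set a; b])%classic c.

Definition complete_lattice (d : Order.disp_t) (L : latticeType d) : Prop :=
  forall X : set L, (supremums X !=set0 /\ infimums X !=set0)%classic.

Definition compact_elements (d : Order.disp_t) (L : latticeType d) : set L :=
  [set c | forall (X : set L) (s : L), supremums X s -> c <= s ->
    exists (F : seq L) (t : L),
      [/\ [set` F] `<=` X, supremums [set` F] t & c <= t]]%classic.
Arguments compact_elements {d} L.

Definition algebraic_lattice (d : Order.disp_t) (L : latticeType d) : Prop :=
  complete_lattice L /\
  forall a : L, exists2 X : set L,
    (X `<=` compact_elements L)%classic & supremums X a.

(* S stands for a subset of L closed under binary joins, regarded as a join
   semilattice with the restricted order.  The unit u is the greatest element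
   of S, which is not assumed to be the top of L. *)
Definition dual_pseudocomplements (d : Order.disp_t) (L : latticeType d)
    (S : set L) (a : L) : set L :=
  [set b | exists2 u, greatest S u &
             least [set x | S x /\ (a `|` x)%O = u] b]%classic.

Definition dually_pseudocomplemented (d : Order.disp_t) (L : latticeType d)
    (S : set L) : Prop :=
  forall a, S a -> (dual_pseudocomplements S a !=set0)%classic.

(* The element a^* of S; the default \bot is returned only when a has no dual
   pseudo-complement in S. *)
Definition dpc (d : Order.disp_t) (L : bLatticeType d) (S : set L) (a : L) : L :=
  xget \bot (dual_pseudocomplements S a).

(* The top element satisfies this predicate and has to be excluded separately. *)
Definition meet_irreducible (d : Order.disp_t) (L : latticeType d) (a : L) :
    Prop :=
  forall x y : L, x `&` y = a -> x = a \/ y = a.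

Definition completely_meet_irreducible (d : Order.disp_t) (L : latticeType d)
    (a : L) : Prop :=
  forall X : set L, infimums X a -> X a.

Definition join_irreducible_in (d : Order.disp_t) (L : latticeType d)
    (A : set L) (p : L) : Prop :=
  forall x y : L, A x -> A y -> x `|` y = p -> x = p \/ y = p.

(* Main.v *)
Require Import Defs.
Local Open Scope order_scope.

Set Implicit Arguments.
Unset Strict Implicit.
Unset Printing Implicit Defensive.

Import Order.TTheory.

(** The implications run in a circle, and those that involve [c*] rest on one
    fact.  Since the compact elements form a semilattice [S] that has a
    greatest element and generates [L], its unit is the top of [L],
    so the top is compact.  Consequently the universal property of the dual
    pseudo-complement [c*] extends from [S] to all of [L]: for every [x] in
    [L], [c + x = 1] if and only if [c* <= x] ([dpcP]).  In particular
    [c* + c** = 1], [c** <= c] and [c* <= c***].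

    (i) implies (ii): a compact lower bound of [a + c*] and [a + c**] uses only
    a compact part of [a] ([compact_le_join]), to which (i) applies; the
    compact elements determine the order of [L].

    (ii) implies (iii): if [a] is meet-irreducible, (ii) puts [c*] or [c**]
    below [a] for every compact [c].  Two elements [x], [y] of [[a, 1)] with
    [x + y = 1] would give a compact [c <= x] with [c* <= y]; then [c* <= a]
    forces [x = 1], while [c** <= a] forces [y = 1].  Hence [[a, 1)] is closed
    under binary joins, and as the top is compact its supremum is still below
    the top.

    (iii) implies (iv): a completely meet-irreducible element is
    meet-irreducible and distinct from the top, and two elements of [[a, 1)]
    have a common upper bound there.

    (iv) implies (i): if a compact [e] lies below [a + c*] and [a + c**] but
    not below [a], Zorn's lemma extends [a] to an element [b] maximal among
    those not above [e]; such a [b] is completely meet-irreducible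
    ([exists_cmi_not_above]).  As [c* + c** = 1], (iv) makes [b + c*] or
    [b + c**] the top, that is, puts [c**] or [c***] (hence [c*]) below [b].
    Either way [e <= b], a contradiction. *)

(** * Compact elements and directed sets *)

Section Lattice.
Variables (d : Order.disp_t) (L : latticeType d).
Implicit Types (a b c x y : L) (D X : set L).

Definition directed D : Prop :=
  forall x y, D x -> D y -> exists z, [/\ D z, x <= z & y <= z].

Lemma directed_join_closed D :
  (forall x y, D x -> D y -> D (x `|` y)) -> directed D.
Proof.
by move=> DU x y Dx Dy; exists (x `|` y); split; [exact: DU|exact: leUl|exact: leUr].
Qed.

Lemma directed_seq_ubound D (F : seq L) :
    D !=set0%classic -> directed D -> ([set` F] `<=` D)%classic ->
  exists2 z, D z & ubound [set` F]%classic z.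
Proof.
move=> [x0 Dx0] dirD; elim: F => [|x F IHF] FD; first by exists x0.
have [z Dz Fz] : exists2 z, D z & ubound [set` F]%classic z.
  by apply: IHF => y /= yF; apply: FD; rewrite /= inE yF orbT.
have [|w [Dw xw zw]] := dirD x z _ Dz; first by apply: FD; rewrite /= mem_head.
exists w => // y; rewrite /= inE => /orP[/eqP -> //|yF].
exact: le_trans (Fz _ yF) zw.
Qed.

(** The form in which compactness is used throughout: the finite subcover has
    an upper bound inside a directed cover. *)
Lemma compact_le_directed c D s :
    compact_elements L c -> D !=set0%classic -> directed D ->
    supremums D s -> c <= s ->
  exists2 x, D x & c <= x.
Proof.
move=> cc D0 dirD supD cs; have [F [t [FD [_ tF] ct]]] := cc _ _ supD cs.
have [z Dz Fz] := directed_seq_ubound D0 dirD FD.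
by exists z => //; exact: le_trans ct (tF _ Fz).
Qed.

Lemma compact_elementsU a b :
  compact_elements L a -> compact_elements L b -> compact_elements L (a `|` b).
Proof.
move=> ca cb X s supX; rewrite leUx => /andP[/(ca _ _ supX)[F [t [FX [Ft tF] at_]]]].
move=> /(cb _ _ supX)[G [u [GX [Gu uG] bu]]].
exists (F ++ G), (t `|` u); split; last exact: leU2.
- by move=> x /=; rewrite mem_cat => /orP[/FX|/GX].
- split=> [x /=|z zFG].
    rewrite mem_cat => /orP[/Ft xt|/Gu xu]; first exact: le_trans xt (leUl _ _).
    exact: le_trans xu (leUr _ _).
  rewrite leUx; apply/andP; split; [apply: tF|apply: uG] => x /= xF.
    by apply: zFG; rewrite /= mem_cat xF.
  by apply: zFG; rewrite /= mem_cat xF orbT.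
Qed.

Lemma completely_meet_irreducible_meet a :
  completely_meet_irreducible a -> meet_irreducible a.
Proof.
move=> cmia x y xya; have : infimums [set x; y]%classic a.
  rewrite -xya; split=> [z /= [] ->|z zxy]; [exact: leIl|exact: leIr|].
  by rewrite lexI !zxy //=; [right|left].
by move=> /cmia /= [] ->; [left|right].
Qed.

End Lattice.

Section BoundedLattice.
Variables (d : Order.disp_t) (L : tbLatticeType d).
Implicit Types (a b c k x y : L).
Local Notation S := (compact_elements L).

Lemma compact_elements0 : S \bot.
Proof. by move=> X s _ _; exists [::], \bot; split=> //; split=> // z _; exact: le0x. Qed.

Lemma completely_meet_irreducible_neq1 a :
  completely_meet_irreducible a -> a <> \top.
Proof.
by move=> cmia a1; apply: (cmia set0); rewrite a1; split=> // z _; exact: lex1.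
Qed.

(** * Separation by completely meet-irreducible elements *)

(** An element maximal among those not above [c] is completely
    meet-irreducible, because anything strictly above it is above [c], and so
    is any meet of such elements.  Compactness of [c] is what lets chains of
    elements not above [c] have a bound of the same kind. *)
Lemma exists_cmi_not_above a c : complete_lattice L -> S c -> ~ c <= a ->
  exists b, [/\ a <= b, ~ c <= b & completely_meet_irreducible b].
Proof.
move=> complL cc nca; pose P := [pred x : L | (a <= x) && ~~ (c <= x)].
have Pa : P a by rewrite /= lexx; exact/negP.
pose T := {x : L | P x}; pose R (x y : T) := val x <= val y.
have [||||[b Pb] bmax] := @Zorn T R.
- by move=> x; exact: lexx.
- by move=> x y z; exact: le_trans.
- by move=> x y xy yx; apply/val_inj/le_anti/andP.
- move=> A totA.
  (* adding [a] to the chain takes care of the empty chain *)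
  pose B := [set x : L | x = a \/ exists2 y : T, A y & x = val y]%classic.
  have [[s supB] _] := complL B; have [Bs _] := supB.
  have dirB : directed B.
    move=> _ _ [->|[x Ax ->]] [->|[y Ay ->]].
    + by exists a; split=> //; left.
    + by exists (val y); split=> //; [right; exists y|case/andP: (valP y)].
    + by exists (val x); split=> //; [right; exists x|case/andP: (valP x)].
    + have [xy|yx] := totA _ _ Ax Ay.
        by exists (val y); split=> //; right; exists y.
      by exists (val x); split=> //; right; exists x.
  have Ps : P s.
    rewrite /= Bs /=; last by left.
    apply/negP => cs.
    have B0 : B !=set0%classic by exists a; left.
    have [x [->|[y _ ->]]] // := compact_le_directed cc B0 dirB supB cs.
    by case/andP: (valP y) => _ /negP.
  by exists (exist _ s Ps) => y Ay; apply: Bs; right; exists y.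
- case/andP: (Pb) => ab /negP ncb; exists b; split=> // X [Xb infb].
  apply: contrapT => nXb; apply: ncb; apply: infb => x Xx.
  apply: contrapT => /negP ncx; have bx := Xb _ Xx.
  have Px : P x by rewrite /= (le_trans ab bx).
  have [xb] := bmax (exist _ x Px) bx.
  by apply: nXb; rewrite -xb.
Qed.

(** * Algebraic lattices *)

Section Algebraic.
Hypothesis algL : algebraic_lattice L.

Lemma algebraic_le a b : (forall k, S k -> k <= a -> k <= b) -> a <= b.
Proof.
move=> kab; have [X XS [Xa aX]] := algL.2 a.
by apply: aX => x Xx; apply: kab; [exact: XS|exact: Xa].
Qed.

(** The joins [k + y] with [k] compact below [a] form a directed set whose
    supremum is [a + y]. *)
Lemma compact_le_join c a y : S c -> c <= a `|` y ->
  exists k, [/\ S k, k <= a & c <= k `|` y].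
Proof.
move=> cc cay; pose D := [set (k `|` y)%O | k in [set k | S k /\ k <= a]]%classic.
have D0 : D !=set0%classic.
  exists (\bot `|` y); exists \bot => //; split; [exact: compact_elements0|exact: le0x].
have dirD : directed D.
  apply: directed_join_closed => _ _ [k [ck ka] <-] [l [cl la] <-].
  exists (k `|` l); last by rewrite [RHS]joinACA joinxx.
  by split; [exact: compact_elementsU|rewrite leUx ka la].
have supD : supremums D (a `|` y).
  split=> [_ [k [_ ka] <-]|z Dz]; first exact: leU2.
  have kyz k : S k -> k <= a -> k `|` y <= z by move=> ? ?; apply: Dz; exists k.
  rewrite leUx; apply/andP; split.
    by apply: algebraic_le => k ck ka; exact: le_trans (leUl _ _) (kyz _ ck ka).
  exact: le_trans (leUr _ _) (kyz _ compact_elements0 (le0x _)).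
by have [_ [k [ck ka] <-] cky] := compact_le_directed cc D0 dirD supD cay; exists k.
Qed.

Lemma greatest_compact u : greatest S u -> u = \top.
Proof.
by move=> [_ Su]; apply/le_anti; rewrite lex1; apply: algebraic_le => k /Su.
Qed.

(** * Dual pseudo-complements of compact elements *)

Section DualPseudocomplement.
Hypothesis dpcS : dually_pseudocomplemented S.
Local Notation "c ^*" := (dpc S c).

Lemma compact_elements1 : S \top.
Proof.
have [b [u Su _]] := dpcS compact_elements0.
by rewrite -(greatest_compact Su); case: Su.
Qed.

Lemma dpc_least c : S c -> least [set x | S x /\ (c `|` x)%O = \top]%classic c^*.
Proof.
move=> cc; have [u /greatest_compact ->] : dual_pseudocomplements S c c^*.
  by apply: xgetPex; exact: dpcS.
by [].
Qed.

Lemma compact_dpc c : S c -> S c^*.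
Proof. by move=> /dpc_least[[]]. Qed.

(** The element [x] need not be compact: the top is, so a compact part of [x]
    already joins with [c] to the top. *)
Lemma dpcP c x : S c -> c `|` x = \top <-> c^* <= x.
Proof.
move=> cc; have [[_ cc1] cmin] := dpc_least cc; split=> [cx1|cx].
  have [|k [ck kx]] := @compact_le_join \top x c compact_elements1.
    by rewrite joinC cx1.
  rewrite le1x joinC => /eqP ck1.
  by apply: le_trans kx; exact: cmin.
by apply/eqP; rewrite -le1x -cc1 leU2.
Qed.

Lemma joinx_dpc c : S c -> c `|` c^* = \top.
Proof. by move=> cc; apply/dpcP. Qed.

Lemma dpc_dpc_le c : S c -> c^*^* <= c.
Proof. by move=> cc; apply/dpcP; [exact: compact_dpc|rewrite joinC joinx_dpc]. Qed.

Lemma dpc_le_dpc_dpc_dpc c : S c -> c^* <= c^*^*^*.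
Proof.
move=> cc; have ccc := compact_dpc (compact_dpc cc).
apply/dpcP => //; apply/eqP; rewrite -le1x -(joinx_dpc ccc).
by rewrite leU2 // dpc_dpc_le.
Qed.

(** * The implications *)

(** The inequality of the meet with [a] is tested on compact elements, each of which involves only a
    compact part of [a]. *)
Lemma dpc_meet_extend :
    (forall a c, S a -> S c -> meet_in S (a `|` c^*) (a `|` c^*^*) a) ->
  forall a c, S c -> a = (a `|` c^*) `&` (a `|` c^*^*).
Proof.
move=> meetS a c cc; apply/le_anti; rewrite lexI !leUl /=.
apply: algebraic_le => e ce; rewrite lexI => /andP[].
move=> /(compact_le_join ce)[k [ck ka ek]] /(compact_le_join ce)[l [cl la el]].
have ckl := compact_elementsU ck cl.
have [_ klmax] := meetS _ _ ckl cc.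
apply: (@le_trans _ _ (k `|` l)); last by rewrite leUx ka la.
apply: klmax; split=> // _ [] ->.
  by apply: le_trans ek _; rewrite leU2 // leUl.
by apply: le_trans el _; rewrite leU2 // leUr.
Qed.

Lemma meet_irreducible_dpc a c :
    a = (a `|` c^*) `&` (a `|` c^*^*) -> meet_irreducible a ->
  c^* <= a \/ c^*^* <= a.
Proof. by move=> /esym meeta /(_ _ _ meeta) [] <-; [left|right]; exact: leUr. Qed.

(** The dichotomy makes [[a, 1)] closed under binary joins:
    a compact [c <= x] witnessing [x + y = 1] has [c* <= y], and whichever of
    [c*], [c**] is below [a] makes [x] or [y] the top. *)
Lemma join_neq1_of_dpc a x y :
    (forall c, S c -> c^* <= a \/ c^*^* <= a) -> a <= x -> a <= y ->
  x `|` y = \top -> x = \top \/ y = \top.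
Proof.
move=> dpca ax ay xy1.
have [|c [cc cx]] := @compact_le_join \top x y compact_elements1; first by rewrite xy1.
rewrite le1x => /eqP /(dpcP _ cc) cy.
have [ca|ca] := dpca c cc; [left|right]; apply/eqP; rewrite -le1x.
  by rewrite -(joinx_dpc cc) leUx cx (le_trans ca).
by rewrite -(joinx_dpc (compact_dpc cc)) leUx cy (le_trans ca).
Qed.

(** Join-irreducibility of the top makes [[a, 1)] directed; its supremum then
    stays below the top, because the top is compact. *)
Lemma join_irreducible_top_greatest a : a <> \top ->
    join_irreducible_in [set x | a <= x]%classic \top ->
  exists m, greatest [set x | a <= x < \top]%classic m.
Proof.
move=> a1 irr1; pose D := [set x : L | a <= x < \top]%classic.
have Da : D a by rewrite /D /= lexx lt_neqAle lex1 andbT; exact/eqP.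
have dirD : directed D.
  apply: directed_join_closed => x y /andP[ax x1] /andP[ay y1]; apply/andP; split.
    exact: le_trans ax (leUl _ _).
  rewrite lt_neqAle lex1 andbT; apply/eqP => /(irr1 _ _ ax ay)[] xy1.
    by rewrite xy1 ltxx in x1.
  by rewrite xy1 ltxx in y1.
have [[m supD] _] := algL.1 D; have [Dm _] := supD.
exists m; split=> //; rewrite /= Dm //= lt_neqAle lex1 andbT; apply/eqP => m1.
have D0 : D !=set0%classic by exists a.
have [|x /andP[_ x1]] := compact_le_directed compact_elements1 D0 dirD supD.
  by rewrite m1.
by rewrite le1x => /eqP xtop; rewrite xtop ltxx in x1.
Qed.

Lemma greatest_join_irreducible_top a m :
    greatest [set x | a <= x < \top]%classic m ->
  join_irreducible_in [set x | a <= x]%classic \top.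
Proof.
move=> [/andP[_ m1] mmax] x y ax ay xy1.
have lem z : a <= z -> z <> \top -> z <= m.
  by move=> az /eqP z1; apply: mmax; rewrite /= az lt_neqAle z1 lex1.
apply: contrapT => /not_orP[x1 y1]; move: m1; rewrite lt_neqAle => /andP[/eqP m1 _].
by apply: m1; apply/eqP; rewrite -le1x -xy1 leUx !lem.
Qed.

(** Separation: a compact element [e] in the meet but not below [a] could be
    kept out of some completely meet-irreducible [b >= a], yet [b] lies above
    [c*] or above [c**] since [c* + c** = 1]. *)
Lemma cmi_meet_dpc a c e :
    (forall b, completely_meet_irreducible b ->
      join_irreducible_in [set x | b <= x]%classic \top) ->
    S c -> S e -> e <= a `|` c^* -> e <= a `|` c^*^* ->
  e <= a.
Proof.
move=> irr1 cc ce e1 e2; apply: contrapT => nea.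
have [b [ab neb cmib]] := exists_cmi_not_above algL.1 ce nea.
have cc' := compact_dpc cc; have cc'' := compact_dpc cc'.
have below z : e <= a `|` z -> z <= b -> False.
  by move=> eaz zb; apply: neb; apply: le_trans eaz _; rewrite leUx ab.
have bcc1 : (b `|` c^*) `|` (b `|` c^*^*) = \top.
  by rewrite joinACA joinx_dpc // joinx1.
have [] := irr1 b cmib _ _ (leUl _ _) (leUl _ _) bcc1; rewrite joinC.
  by move=> /(dpcP _ cc'); exact: below.
move=> /(dpcP _ cc'') cb; apply: (below _ e1).
exact: le_trans (dpc_le_dpc_dpc_dpc cc) cb.
Qed.

End DualPseudocomplement.
End Algebraic.
End BoundedLattice.

Theorem theorem6p2 (d : Order.disp_t) (L : tbLatticeType d)
    (algL : algebraic_lattice L)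
    (dpcS : dually_pseudocomplemented (compact_elements L)) :
  [<->
    (* (i) *)
    forall a c : L, compact_elements L a -> compact_elements L c ->
      meet_in (compact_elements L)
        (a `|` dpc (compact_elements L) c)
        (a `|` dpc (compact_elements L) (dpc (compact_elements L) c))
        a;
    (* (ii) *)
    forall a c : L, compact_elements L c ->
      a = (a `|` dpc (compact_elements L) c) `&`
          (a `|` dpc (compact_elements L) (dpc (compact_elements L) c));
    (* (iii) *)
    forall a : L, a <> \top -> meet_irreducible a ->
      exists m : L, greatest [set x : L | a <= x < \top]%classic m;
    (* (iv) *)
    forall a : L, completely_meet_irreducible a ->
      join_irreducible_in [set x : L | a <= x]%classic \top].
Proof.
tfae.
- exact: dpc_meet_extend.
- move=> meetL a a1 irra; apply: join_irreducible_top_greatest => //.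
  move=> x y; apply: join_neq1_of_dpc => // c cc.
  by apply: meet_irreducible_dpc => //; exact: meetL.
- move=> maxL a cmia.
  have [m] := maxL a (completely_meet_irreducible_neq1 cmia)
    (completely_meet_irreducible_meet cmia).
  exact: greatest_join_irreducible_top.
- move=> irr1 a c ca cc; split.
    by split=> // _ [] ->; exact: leUl.
  move=> e [ce lbe]; apply: (cmi_meet_dpc algL dpcS irr1 cc ce); apply: lbe.
    by left.
  by right.
Qed.
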